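(* Let $\mathcal A$ be an algebra. The following are equivalent: (1) $\mathcal A$ is strongly AUF. (2) $\mathcal A$ is isomorphic to $\mathrm{End}^0_{-,B}(M)$, where $B$ is a unital finite-dimensional algebra, $M$ is a projective generator in the category $\mathrm{Mod}^{\mathrm R}(B)$ of right $B$-modules, the vector space $M$ has a grading $M=\bigoplus_{i\in\mathfrak I}M(i)$ in which each $M(i)$ is finite-dimensional and preserved by the right action of $B$, and $$\mathrm{End}^0_{-,B}(M)=\{T\in\mathrm{End}(M): (Tm)b=T(mb)\ \forall m\in M,b\in B,\ \text{and } T|_{M(i)}=0 \text{ for all but finitely many } i\in\mathfrak I\}.$$
   Context: All algebras are associative $\mathbb C$-algebras, not necessarily unital. An idempotent is an element $e$ with $e^2=e$. An algebra $A$ is AUF if there is a family $(e_i)_{i\in\mathfrak I}$ of mutually orthogonal idempotents ($e_ie_j=0$ for $i\ne j$) with $\dim e_iAe_j<\infty$ for all $i,j$ and $A=\sum_{i,j}e_iAe_j$ (every element is a finite sum of elements of the spaces $e_iAe_j$). A left $A$-module $M$ is quasicoherent if $\xi\in A\xi$ for all $\xi\in M$. Irreducible means nonzero with no nonzero proper submodules. An idempotent $e\in A$ is generating if every irreducible quasicoherent left $A$-module is a quotient of $Ae$; $A$ is strongly AUF if it is AUF and has a generating idempotent. A projective generator in $\mathrm{Mod}^{\mathrm R}(B)$ is a right $B$-module that is projective in $\mathrm{Mod}^{\mathrm R}(B)$ and such that every right $B$-module is an epimorphic image of a (possibly infinite) direct sum of copies of it. *)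

(* Defs.v *)
From HB Require Import structures.
From mathcomp Require Import all_boot all_order all_algebra.
From mathcomp Require Import complex.
From mathcomp Require Import reals Rstruct.
Set Implicit Arguments. Unset Strict Implicit. Unset Printing Implicit Defensive.
Import Order.TTheory GRing.Theory Num.Theory.
Local Open Scope ring_scope.

Definition CC : fieldType := (Rdefinitions.R)[i].

Section Defs.
Variable K : fieldType.

Record nualg := NUAlg {
  nua_sort :> lmodType K;
  nua_mul : nua_sort -> nua_sort -> nua_sort;
  nua_mulA : forall x y z, nua_mul x (nua_mul y z) = nua_mul (nua_mul x y) z;
  nua_mulDl : forall x y z, nua_mul (x + y) z = nua_mul x z + nua_mul y z;
  nua_mulDr : forall x y z, nua_mul x (y + z) = nua_mul x y + nua_mul x z;
  nua_mulZl : forall (c : K) x y, nua_mul (c *: x) y = c *: nua_mul x y;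
  nua_mulZr : forall (c : K) x y, nua_mul x (c *: y) = c *: nua_mul x y
}.

(* unital associative K-algebra (the zero algebra is allowed) *)
Record ualg := UAlg {
  ua_alg :> nualg;
  ua_one : ua_alg;
  ua_mul1l : forall x, nua_mul ua_one x = x;
  ua_mul1r : forall x, nua_mul x ua_one = x
}.

Definition findim (V : lmodType K) (P : V -> Prop) : Prop :=
  exists s : seq V, forall v, P v ->
    exists c : 'I_(size s) -> K, v = \sum_(k < size s) c k *: s`_k.

Definition subspace (V : lmodType K) (P : V -> Prop) : Prop :=
  P 0 /\ (forall x y, P x -> P y -> P (x + y)) /\
  (forall (c : K) x, P x -> P (c *: x)).

Definition idempotent (A : nualg) (e : A) : Prop := nua_mul e e = e.

Definition AUF (A : nualg) : Prop :=
  exists (I : Type) (e : I -> A),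
    (forall i, idempotent (e i)) /\
    (forall i j, i <> j -> nua_mul (e i) (e j) = 0) /\
    (forall i j, findim (fun x : A => exists y : A, x = nua_mul (nua_mul (e i) y) (e j))) /\
    (forall x : A, exists (n : nat) (ij : 'I_n -> I * I) (y : 'I_n -> A),
        x = \sum_(k < n) nua_mul (nua_mul (e (ij k).1) (y k)) (e (ij k).2)).

Record lmodule (A : nualg) := LModule {
  lm_sort :> lmodType K;
  lm_act : A -> lm_sort -> lm_sort;
  lm_actDl : forall a b m, lm_act (a + b) m = lm_act a m + lm_act b m;
  lm_actDr : forall a m n, lm_act a (m + n) = lm_act a m + lm_act a n;
  lm_actZl : forall (c : K) a m, lm_act (c *: a) m = c *: lm_act a m;
  lm_actZr : forall (c : K) a m, lm_act a (c *: m) = c *: lm_act a m;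
  lm_actA : forall a b m, lm_act (nua_mul a b) m = lm_act a (lm_act b m)
}.

Definition quasicoherent (A : nualg) (M : lmodule A) : Prop :=
  forall xi : M, exists a : A, lm_act a xi = xi.

Definition lsubmodule (A : nualg) (M : lmodule A) (P : M -> Prop) : Prop :=
  subspace P /\ (forall (a : A) (m : M), P m -> P (lm_act a m)).

Definition irreducible (A : nualg) (M : lmodule A) : Prop :=
  (exists m : M, m <> 0) /\
  (forall P : M -> Prop, lsubmodule P -> (exists m, P m /\ m <> 0) -> forall m, P m).

(* M is a quotient of the left module A e = {a e : a in A}: there is a
   surjective module homomorphism f : A e -> M (given by its values on A e) *)
Definition quotient_of_Ae (A : nualg) (e : A) (M : lmodule A) : Prop :=
  let Ae := fun x : A => exists a : A, x = nua_mul a e in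
  exists f : A -> M,
    (forall x y, Ae x -> Ae y -> f (x + y) = f x + f y) /\
    (forall (c : K) x, Ae x -> f (c *: x) = c *: f x) /\
    (forall a x, Ae x -> f (nua_mul a x) = lm_act a (f x)) /\
    (forall m : M, exists x, Ae x /\ f x = m).

Definition generating (A : nualg) (e : A) : Prop :=
  idempotent e /\
  forall M : lmodule A, quasicoherent M -> irreducible M -> quotient_of_Ae e M.

Definition strongly_AUF (A : nualg) : Prop :=
  AUF A /\ exists e : A, generating e.

Record rmodule (B : ualg) := RModule {
  rm_sort :> lmodType K;
  rm_act : rm_sort -> B -> rm_sort;
  rm_actDl : forall m n b, rm_act (m + n) b = rm_act m b + rm_act n b;
  rm_actDr : forall m b c, rm_act m (b + c) = rm_act m b + rm_act m c;
  rm_actZl : forall (c : K) m b, rm_act (c *: m) b = c *: rm_act m b;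
  rm_actZr : forall (c : K) m b, rm_act m (c *: b) = c *: rm_act m b;
  rm_actA : forall m b c, rm_act m (nua_mul b c) = rm_act (rm_act m b) c;
  rm_act1 : forall m, rm_act m (ua_one B) = m
}.

Definition klinear (V W : lmodType K) (f : V -> W) : Prop :=
  (forall x y, f (x + y) = f x + f y) /\ (forall (c : K) x, f (c *: x) = c *: f x).

Definition rhom (B : ualg) (M N : rmodule B) (f : M -> N) : Prop :=
  klinear f /\ (forall m b, f (rm_act m b) = rm_act (f m) b).

Definition rprojective (B : ualg) (M : rmodule B) : Prop :=
  forall (N P : rmodule B) (g : N -> P) (f : M -> P),
    rhom g -> (forall p : P, exists n : N, g n = p) -> rhom f ->
    exists h : M -> N, rhom h /\ forall m, g (h m) = f m.

(* every right B-module N is an epimorphic image of a direct sum of copies of M: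
   a homomorphism from the direct sum over J of copies of M is given by a family
   (f j)_{j in J} of homomorphisms M -> N, and it is onto iff every element of N
   is a finite sum of elements of the form f j m *)
Definition rgenerator (B : ualg) (M : rmodule B) : Prop :=
  forall N : rmodule B, exists (J : Type) (f : J -> M -> N),
    (forall j, rhom (f j)) /\
    (forall n : N, exists (k : nat) (j : 'I_k -> J) (m : 'I_k -> M),
        n = \sum_(t < k) f (j t) (m t)).

Definition projective_generator (B : ualg) (M : rmodule B) : Prop :=
  rprojective M /\ rgenerator M.

Definition graded (B : ualg) (M : rmodule B) (I : Type) (G : I -> M -> Prop) : Prop :=
  (forall i, subspace (G i)) /\
  (forall i, findim (G i)) /\
  (forall i m b, G i m -> G i (rm_act m b)) /\
  (forall m : M, exists (n : nat) (idx : 'I_n -> I) (x : 'I_n -> M),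
      (forall k, G (idx k) (x k)) /\ m = \sum_(k < n) x k) /\
  (forall (n : nat) (idx : 'I_n -> I) (x : 'I_n -> M),
      injective idx -> (forall k, G (idx k) (x k)) ->
      \sum_(k < n) x k = 0 -> forall k, x k = 0).

Definition End0 (B : ualg) (M : rmodule B) (I : Type) (G : I -> M -> Prop)
  (T : M -> M) : Prop :=
  klinear T /\
  (forall m b, T (rm_act m b) = rm_act (T m) b) /\
  (exists (n : nat) (s : 'I_n -> I),
      forall i, (forall k, s k <> i) -> forall m, G i m -> T m = 0).

Definition iso_End0 (A : nualg) (B : ualg) (M : rmodule B) (I : Type)
  (G : I -> M -> Prop) : Prop :=
  exists Phi : A -> M -> M,
    (forall a, End0 G (Phi a)) /\
    (forall a b m, Phi (a + b) m = Phi a m + Phi b m) /\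
    (forall (c : K) a m, Phi (c *: a) m = c *: Phi a m) /\
    (forall a b m, Phi (nua_mul a b) m = Phi a (Phi b m)) /\
    (forall a b, (forall m, Phi a m = Phi b m) -> a = b) /\
    (forall T, End0 G T -> exists a, forall m, Phi a m = T m).

End Defs.

(* Main.v *)
(* If [a] is a generating idempotent of an AUF algebra [A], then [A = AaA]: otherwise some
   [e_i] lies outside [AaA], and a maximal left ideal containing [AaA] but not [e_i] gives an
   irreducible module killed by [a], which cannot be a quotient of [Aa].  Writing [e_i] as a
   finite sum of elements [x a y] then provides a finite dual basis of each [e_i A a] over
   [B = aAa]; hence [M = Aa], graded by the [e_i A a], is projective over [B], and every
   endomorphism in [End^0] is a left multiplication.
   Conversely, the projections [e_i] of [M] onto its homogeneous parts make [End^0] an AUF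
   algebra.  As [M] generates, [1_B] is a finite sum of values of homomorphisms [M -> B] on
   elements of some [M_F], the sum of the [M(i)] for [i] in a finite set [F].  So a finite
   power of [M_F] maps onto [M(i)], and since [M] is projective this splits, which puts
   [e_i] in the two-sided ideal of [u = sum_(i in F) e_i]; thus [u] is generating. *)
From HB Require Import structures.
From mathcomp Require Import all_boot all_order all_algebra.
From mathcomp Require Import boolp.
From mathcomp Require classical_sets.
Require Import Defs.
Set Implicit Arguments. Unset Strict Implicit. Unset Printing Implicit Defensive.
Import GRing.Theory.
Local Open Scope ring_scope.

Local Notation "x ** y" := (nua_mul x y) (at level 40, left associativity).

(** Both sums reduce to their nonzero terms, and the indices of these form the same set in [s] and
    in [t]. This lets finite sums indexed by different supports be compared. *)
Lemma big_supp (V : nmodType) (I : eqType) (s t : seq I) (F : I -> V) :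
  uniq s -> uniq t ->
  (forall i, i \notin s -> F i = 0) -> (forall i, i \notin t -> F i = 0) ->
  \sum_(i <- s) F i = \sum_(i <- t) F i.
Proof.
move=> us ut Fs Ft.
have restr (r : seq I) :
    \sum_(i <- r) F i = \sum_(i <- [seq i <- r | F i != 0]) F i.
  by rewrite big_filter; apply/esym/big_rmcond => i /negPn/eqP.
rewrite (restr s) (restr t); apply/perm_big/uniq_perm; rewrite ?filter_uniq //.
move=> i; rewrite !mem_filter; case: eqP => //= /eqP Fi.
have -> : i \in s by apply: contraT => /Fs/eqP; rewrite (negPf Fi).
by have -> : i \in t by apply: contraT => /Ft/eqP; rewrite (negPf Fi).
Qed.

(** * Finite dimension, through spanning families and through linear dependence *)

Section FiniteDimension.
Variable K : fieldType.

Lemma klinear0 (V W : lmodType K) (f : V -> W) : klinear f -> f 0 = 0.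
Proof. by move=> [_ fZ]; rewrite -(scale0r 0) fZ scale0r. Qed.

Lemma klinear_sum (V W : lmodType K) (f : V -> W) (I : Type) (s : seq I)
    (F : I -> V) :
  klinear f -> f (\sum_(i <- s) F i) = \sum_(i <- s) f (F i).
Proof. by move=> f_lin; apply: big_morph; [case: f_lin | exact: klinear0]. Qed.

Lemma klinearB (V W : lmodType K) (f : V -> W) x y :
  klinear f -> f (x - y) = f x - f y.
Proof. by move=> [fD fZ]; rewrite -scaleN1r fD fZ scaleN1r. Qed.

Lemma subspace_sum (V : lmodType K) (P : V -> Prop) (I : Type) (s : seq I)
    (F : I -> V) :
  subspace P -> (forall i, P (F i)) -> P (\sum_(i <- s) F i).
Proof. by move=> [P0 [PD _]] PF; apply: big_ind. Qed.

Lemma subspaceB (V : lmodType K) (P : V -> Prop) x y :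
  subspace P -> P x -> P y -> P (x - y).
Proof. by move=> [_ [PD PZ]] Px Py; apply: PD => //; rewrite -scaleN1r; apply: PZ. Qed.

(** [findim] does not ask the spanning vectors to lie in [P], so any finite family whose span
    contains [P] will do. *)
Lemma findim_fin (V : lmodType K) (P : V -> Prop) (J : finType) (v : J -> V) :
  (forall x, P x -> exists c : J -> K, x = \sum_j c j *: v j) -> findim P.
Proof.
move=> span; exists [seq v j | j <- enum J] => x /span[c ->].
have sz : size [seq v j | j <- enum J] = #|J| by rewrite size_map -cardE.
exists (fun k => c (enum_val (cast_ord sz k))).
rewrite (reindex (enum_val \o cast_ord sz)) /=; last first.
  apply: onW_bij; apply: bij_comp (enum_val_bij J) _.
  by exists (cast_ord (esym sz)); [exact: cast_ordK | exact: cast_ordKV].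
apply: eq_bigr => k _; congr (_ *: _).
have k_lt : (k < size (enum J))%N by rewrite -cardE -sz.
by rewrite (nth_map (enum_val (cast_ord sz k))) // -(enum_val_nth _ (cast_ord sz k)).
Qed.

Lemma findim_image (V W : lmodType K) (P : V -> Prop) (Q : W -> Prop)
    (f : V -> W) :
  klinear f -> (forall y, Q y -> exists2 x, P x & f x = y) ->
  findim P -> findim Q.
Proof.
move=> f_lin PQ [s span]; apply: (@findim_fin _ _ _ (fun k : 'I_(size s) => f s`_k)).
move=> _ /PQ[x /span[c ->] <-]; exists c.
by rewrite klinear_sum //; apply: eq_bigr => k _; case: f_lin => _ ->.
Qed.

Lemma findim_sum (V : lmodType K) (I : Type) (s : seq I) (P : I -> V -> Prop) :
  (forall i, findim (P i)) ->
  findim (fun x => exists2 y : I -> V, (forall i, P i (y i)) & x = \sum_(i <- s) y i).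
Proof.
move=> finP; elim: s => [|i s IHs].
  by exists [::] => x [y _ ->]; exists (fun=> 0); rewrite big_nil big_ord0.
case: IHs (finP i) => r span [r' span'].
apply: (@findim_fin _ _ _ (fun k : 'I_(size r') + 'I_(size r) =>
  match k with inl k => r'`_k | inr k => r`_k end)) => _ [y Py ->].
have [c' yi] := span' _ (Py i).
have [|c ys] := span (\sum_(j <- s) y j); first by exists y.
exists (fun k => match k with inl k => c' k | inr k => c k end).
by rewrite big_cons yi ys big_sumType.
Qed.

Lemma scale_ffunE (V : lmodType K) (J : finType) (c : K) (f : {ffun J -> V}) j :
  (c *: f) j = c *: f j.
Proof. exact: ffunE. Qed.

Lemma findim_ffun (V : lmodType K) (P : V -> Prop) (J : finType) :
  findim P -> findim (fun f : {ffun J -> V} => forall j, P (f j)).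
Proof.
case=> s span.
(* The spanning functions are supported at one point, with a value taken from [s]. *)
apply: (@findim_fin _ _ _ (fun jk : J * 'I_(size s) =>
  [ffun j => if j == jk.1 then s`_jk.2 else 0])) => f Pf.
have [c cP] := choice (fun j => span _ (Pf j)).
exists (fun jk => c jk.1 jk.2); apply/ffunP => j.
rewrite sum_ffunE (eq_bigr (fun jk : J * 'I_(size s) =>
  c jk.1 jk.2 *: (if j == jk.1 then s`_jk.2 else 0))); last first.
  by move=> jk _; rewrite scale_ffunE ffunE.
rewrite -(pair_bigA _ (fun j1 k => c j1 k *: (if j == j1 then s`_k else 0))) /=.
rewrite (bigD1 j) //= [X in _ + X]big1 ?addr0 => [|j1 j1j]; last first.
  by apply: big1 => k _; rewrite eq_sym (negPf j1j) scaler0.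
by rewrite cP; apply: eq_bigr => k _; rewrite eqxx.
Qed.

Definition dependent (V : lmodType K) n (v : 'I_n -> V) :=
  exists2 c : 'I_n -> K, exists i, c i != 0 & \sum_i c i *: v i = 0.

(** With more vectors than generators, the coefficient matrix has more rows than columns, and a
    nonzero row of its left kernel is a relation. Unlike a spanning list, this criterion pulls back
    along injective maps. *)
Lemma findim_dependent (V : lmodType K) (P : V -> Prop) :
  findim P -> exists n, forall v : 'I_n.+1 -> V, (forall i, P (v i)) -> dependent v.
Proof.
case=> s span; exists (size s) => v Pv.
have [c cP] := choice (fun i => span _ (Pv i)).
pose M : 'M[K]_((size s).+1, size s) := \matrix_(i, k) c i k.
have : kermx M != 0.
  by rewrite kermx_eq0 -row_leq_rank -ltnNge ltnS rank_leq_col.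
case/rowV0Pn => d /sub_kermxP dM d0.
exists (d 0).
  by case/rV0Pn: d0 => i; exists i.
under eq_bigr do rewrite cP scaler_sumr.
rewrite exchange_big /= big1 // => k _.
under eq_bigr do rewrite scalerA.
rewrite -scaler_suml; apply/eqP; rewrite scaler_eq0; apply/orP/or_introl/eqP.
have -> : \sum_i d 0 i * c i k = (d *m M) 0 k.
  by rewrite mxE; apply: eq_bigr => i _; rewrite mxE.
by rewrite dM mxE.
Qed.

(** Induction on [n]: either all families of [n.+1] vectors of [P] are dependent as well, or one is
    independent, and then it spans [P]. *)
Lemma dependent_findim (V : lmodType K) (P : V -> Prop) n :
  (forall v : 'I_n.+1 -> V, (forall i, P (v i)) -> dependent v) -> findim P.
Proof.
elim: n => [|n IHn] depP.
  exists [::] => x Px; exists (fun=> 0); rewrite big_ord0.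
  have [c [i ci]] := depP (fun=> x) (fun=> Px).
  rewrite big_ord1 => /eqP; rewrite scaler_eq0 => /orP[|/eqP//].
  by move: ci; rewrite (ord1 i) => /negPf->.
have [|] := pselect (forall v : 'I_n.+1 -> V, (forall i, P (v i)) -> dependent v).
  exact: IHn.
rewrite -existsNE => -[v /not_implyP[Pv indep]].
apply: (@findim_fin _ _ _ v) => x Px.
(* The vector [x] is adjoined to [v] at index 0. In a relation its coefficient is nonzero, since [v]
   is independent, so [x] can be solved for. *)
pose w (i : 'I_n.+2) := if unlift ord0 i is Some j then v j else x.
have [|c [i ci] csum] := depP w.
  by move=> i; rewrite /w; case: (unlift _ i).
move: csum; rewrite big_ord_recl {1}/w unlift_none.
under eq_bigr do rewrite /w liftK.
have [c0|c0] := eqVneq (c ord0) 0.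
  rewrite c0 scale0r add0r => csum; case: indep.
  exists (fun j => c (lift ord0 j)) => //.
  case: (unliftP ord0 i) ci => [j|] -> ci; first by exists j.
  by rewrite c0 eqxx in ci.
move=> /eqP; rewrite addr_eq0 => /eqP csum.
exists (fun j => - ((c ord0)^-1 * c (lift ord0 j))).
apply: (scalerI c0); rewrite csum scaler_sumr -sumrN.
apply: eq_bigr => j _.
by rewrite scalerA mulrN mulVKf // scaleNr.
Qed.

(** A relation between the images of the [v i] says that [f] kills the same combination of the
    [v i], which is therefore zero. *)
Lemma findim_inj (V W : lmodType K) (P : V -> Prop) (Q : W -> Prop)
    (f : V -> W) :
  klinear f -> subspace P -> (forall x, P x -> f x = 0 -> x = 0) ->
  (forall x, P x -> Q (f x)) -> findim Q -> findim P.
Proof.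
move=> f_lin P_sub f_inj PQ /findim_dependent[n dep].
apply: (@dependent_findim _ _ n) => v Pv.
have [c ci csum] := dep (f \o v) (fun i => PQ _ (Pv i)).
exists c => //; apply: f_inj.
  by apply: subspace_sum => // i; case: P_sub => _ [_]; apply.
by rewrite klinear_sum // -[RHS]csum; apply: eq_bigr => i _; case: f_lin => _ ->.
Qed.

End FiniteDimension.

(** * Subspaces and quotients as vector spaces *)

Section Subspace.
Variables (K : fieldType) (V : lmodType K) (P : V -> Prop) (P_sub : subspace P).

(** The proof of [subspace P] occurs in the term so that the closedness instance can be attached to
    it. *)
Definition subsp_pred of subspace P : {pred V} := fun x => `[< P x >].

Lemma subsp_pred_closed : submod_closed (subsp_pred P_sub).
Proof.
case: P_sub => P0 [PD PZ]; split=> [|c x y /asboolP Px /asboolP Py]; apply/asboolP => //.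
exact/PD/Py/PZ.
Qed.

HB.instance Definition _ :=
  GRing.isSubmodClosed.Build K V (subsp_pred P_sub) subsp_pred_closed.

Definition subsp : Type := {x : V | subsp_pred P_sub x}.
HB.instance Definition _ := SubChoice.on subsp.
HB.instance Definition _ := [SubChoice_isSubLmodule of subsp by <:].

Lemma subspP (x : subsp) : P (val x).
Proof. by case: x => x /= /asboolP. Qed.

Definition to_subsp x (Px : P x) : subsp := Sub x (asboolT Px).

Lemma to_subspK x (Px : P x) : val (to_subsp Px) = x.
Proof. exact: SubK. Qed.

Lemma subsp_inj (x y : subsp) : val x = val y -> x = y.
Proof. exact: val_inj. Qed.

Lemma subspD (x y : subsp) : val (x + y) = val x + val y.
Proof. exact: raddfD. Qed.

Lemma subspZ (c : K) (x : subsp) : val (c *: x) = c *: val x.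
Proof. exact: linearZ. Qed.

Lemma subsp_klinear : klinear (val : subsp -> V).
Proof. by split; [exact: subspD | exact: subspZ]. Qed.

End Subspace.

(* The quotient space is carried by canonical representatives of the classes. *)
Section Quotient.
Variables (K : fieldType) (V : lmodType K) (N : V -> Prop) (N_sub : subspace N).

Definition coset_repr of subspace N := fun x : V => choose (fun y => `[< N (x - y) >]) x.
Local Notation repr := (coset_repr N_sub).

Lemma sub_reprP x : N (x - repr x).
Proof.
apply/asboolP; rewrite /coset_repr; apply: (@chooseP _ (fun y => `[< N (x - y) >])).
by apply/asboolP; rewrite subrr; case: N_sub.
Qed.

(** Congruent vectors define the same predicate, and [choose] gives the same result for all starting
    points that satisfy it. *)
Lemma eq_reprP x y : repr x = repr y <-> N (x - y).
Proof.
split=> [xy|Nxy].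
  rewrite -(subrK (repr x) x) -addrA {2}xy -[repr y - y]opprB.
  by apply: subspaceB => //; apply: sub_reprP.
rewrite /coset_repr.
have eqN : (fun z => `[< N (x - z) >]) =1 (fun z => `[< N (y - z) >]).
  move=> z; apply/asboolP/asboolP => Nz.
    have -> : y - z = (x - z) - (x - y) by rewrite opprB [RHS]addrC addrA subrK.
    exact: subspaceB.
  by rewrite -[x](subrK y) -addrA; case: N_sub => _ [+ _]; apply.
rewrite (eq_choose eqN); apply: choose_id => //; apply/asboolP.
  by rewrite -[_ - _]opprB -scaleN1r; case: N_sub => _ [_]; apply.
by rewrite subrr; case: N_sub.
Qed.

Definition quot_pred : pred V := fun x => repr x == x.
Definition quot : Type := {x : V | quot_pred x}.
HB.instance Definition _ := SubChoice.on quot.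

Lemma quot_predP x : quot_pred (repr x).
Proof. by apply/eqP/esym/eq_reprP/sub_reprP. Qed.

Definition coset x : quot := Sub (repr x) (quot_predP x).

Lemma coset_val (q : quot) : coset (val q) = q.
Proof. by apply: val_inj; rewrite /=; apply/eqP; case: q. Qed.

Lemma eq_cosetP x y : coset x = coset y <-> N (x - y).
Proof.
by rewrite -eq_reprP; split=> [/(congr1 val)//|xy]; apply: val_inj.
Qed.

Lemma sub_cosetP x : N (x - val (coset x)).
Proof. exact: sub_reprP. Qed.

Lemma sub_cosetP' x : N (val (coset x) - x).
Proof. by rewrite -opprB -scaleN1r; case: N_sub => _ [_]; apply; apply: sub_cosetP. Qed.

Definition quot_add (p q : quot) := coset (val p + val q).
Definition quot_opp (p : quot) := coset (- val p).
Definition quot_scale (c : K) (p : quot) := coset (c *: val p).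

Lemma coset_add x y : quot_add (coset x) (coset y) = coset (x + y).
Proof.
apply/eq_cosetP; rewrite opprD addrACA.
by case: N_sub => _ [ND _]; apply: ND; apply: sub_cosetP'.
Qed.

Lemma coset_scale c x : quot_scale c (coset x) = coset (c *: x).
Proof.
apply/eq_cosetP; rewrite -scalerBr.
by case: N_sub => _ [_]; apply; apply: sub_cosetP'.
Qed.

Lemma coset_opp x : quot_opp (coset x) = coset (- x).
Proof. by rewrite -[- x]scaleN1r -coset_scale /quot_opp -scaleN1r. Qed.

Lemma cosetW (Q : quot -> Prop) : (forall x, Q (coset x)) -> forall q, Q q.
Proof. by move=> Qc q; rewrite -(coset_val q). Qed.

Lemma quot_addA : associative quot_add.
Proof.
by do 3!elim/cosetW => ?; rewrite !coset_add addrA.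
Qed.

Lemma quot_addC : commutative quot_add.
Proof. by do 2!elim/cosetW => ?; rewrite !coset_add addrC. Qed.

Lemma quot_add0 : left_id (coset 0) quot_add.
Proof. by elim/cosetW => ?; rewrite coset_add add0r. Qed.

Lemma quot_addN : left_inverse (coset 0) quot_opp quot_add.
Proof. by elim/cosetW => ?; rewrite coset_opp coset_add addNr. Qed.

HB.instance Definition _ :=
  GRing.isZmodule.Build quot quot_addA quot_addC quot_add0 quot_addN.

Lemma quot_scaleA (a b : K) (p : quot) :
  quot_scale a (quot_scale b p) = quot_scale (a * b) p.
Proof. by elim/cosetW: p => ?; rewrite !coset_scale scalerA. Qed.

Lemma quot_scale1 : left_id 1 quot_scale.
Proof. by elim/cosetW => ?; rewrite coset_scale scale1r. Qed.

Lemma quot_scaleDr : right_distributive quot_scale +%R.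
Proof.
move=> c; elim/cosetW => x; elim/cosetW => y; change +%R with quot_add.
by rewrite !(coset_add, coset_scale) scalerDr.
Qed.

Lemma quot_scaleDl (p : quot) :
  {morph quot_scale^~ p : a b / (a + b)%R}.
Proof.
move=> a b; elim/cosetW: p => x; rewrite !coset_scale scalerDl.
exact/esym/coset_add.
Qed.

HB.instance Definition _ := GRing.Zmodule_isLmodule.Build K quot
  quot_scaleA quot_scale1 quot_scaleDr quot_scaleDl.

Lemma coset_klinear : klinear (coset : V -> quot).
Proof.
by split=> [x y|c x]; [exact: esym (coset_add x y) | exact: esym (coset_scale c x)].
Qed.

Lemma coset_eq0 x : coset x = 0 <-> N x.
Proof. by rewrite -[x in N x]subr0 -eq_cosetP. Qed.

End Quotient.

(** * The ideals $AeA$, full idempotents, and quotients of $A$ by left ideals *)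

Section Algebra.
Variables (K : fieldType) (A : nualg K).
Implicit Types a b e x y : A.

Lemma mull_klinear a : klinear (nua_mul a).
Proof. by split=> [x y|c x]; rewrite (nua_mulDr, nua_mulZr). Qed.

Lemma mulr_klinear a : klinear (fun x => x ** a).
Proof. by split=> [x y|c x]; rewrite (nua_mulDl, nua_mulZl). Qed.

Lemma nua_mulr0 a : a ** 0 = 0. Proof. exact: klinear0 (mull_klinear a). Qed.
Lemma nua_mul0r a : 0 ** a = 0. Proof. exact: klinear0 (mulr_klinear a). Qed.

Lemma nua_mul_sumr a (I : Type) (s : seq I) (F : I -> A) :
  a ** (\sum_(i <- s) F i) = \sum_(i <- s) a ** F i.
Proof. exact: klinear_sum (mull_klinear a). Qed.

Lemma nua_mul_suml a (I : Type) (s : seq I) (F : I -> A) :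
  (\sum_(i <- s) F i) ** a = \sum_(i <- s) F i ** a.
Proof. exact: klinear_sum (mulr_klinear a). Qed.

(** The ideal $AeA$. It contains [e] when [e] is idempotent, because $e = eee$. *)
Definition two_sided e x : Prop :=
  exists s : seq (A * A), x = \sum_(p <- s) p.1 ** e ** p.2.

Definition full e : Prop := forall x, two_sided e x.

Lemma two_sided_sum e (I : Type) (s : seq I) (F : I -> A) :
  (forall i, two_sided e (F i)) -> two_sided e (\sum_(i <- s) F i).
Proof.
move=> FJ; apply: big_ind => [|x y [s1 ->] [s2 ->]|i _].
- by exists [::]; rewrite big_nil.
- by exists (s1 ++ s2); rewrite big_cat.
- exact: FJ.
Qed.

Lemma two_sided_mull e a x : two_sided e x -> two_sided e (a ** x).
Proof.
case=> s ->; exists [seq (a ** p.1, p.2) | p <- s].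
by rewrite big_map nua_mul_sumr; apply: eq_bigr => p _; rewrite !nua_mulA.
Qed.

Lemma two_sided_mulr e a x : two_sided e x -> two_sided e (x ** a).
Proof.
case=> s ->; exists [seq (p.1, p.2 ** a) | p <- s].
by rewrite big_map nua_mul_suml; apply: eq_bigr => p _; rewrite !nua_mulA.
Qed.

Lemma two_sided_mid e a b : two_sided e (a ** e ** b).
Proof. by exists [:: (a, b)]; rewrite big_seq1. Qed.

Lemma two_sided_subspace e : subspace (two_sided e).
Proof.
split; first by exists [::]; rewrite big_nil.
split=> [x y [s1 ->] [s2 ->]|c x [s ->]]; first by exists (s1 ++ s2); rewrite big_cat.
exists [seq (c *: p.1, p.2) | p <- s]; rewrite big_map scaler_sumr.
by apply: eq_bigr => p _; rewrite !nua_mulZl.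
Qed.

Lemma lm_act_klinear (M : lmodule A) (m : M) : klinear (fun a => lm_act a m).
Proof. by split=> [x y|c x]; rewrite (lm_actDl, lm_actZl). Qed.

Lemma lm_act0 (M : lmodule A) a : lm_act a (0 : M) = 0.
Proof. by rewrite -(scale0r 0) lm_actZr !scale0r. Qed.

(** If [e] killed [M], so would $AeA = A$, against $\xi \in A\xi$ for a nonzero $\xi$. Hence $em \ne
    0$ for some [m], and $x \mapsto xm$ maps $Ae$ onto a submodule containing $em$, that is, onto
    [M]. *)
Lemma full_generating e : idempotent e -> full e -> generating e.
Proof.
move=> ee e_full; split=> // M qcM [[xi xi0] irrM].
have [m em0] : exists m : M, lm_act e m <> 0.
  apply: contrapT => noe; apply: xi0.
  have [a aE] := qcM xi; have [s sE] := e_full a.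
  rewrite -aE sE (klinear_sum _ _ (lm_act_klinear xi)) big1 // => p _.
  rewrite -nua_mulA !lm_actA; have [em|em] := pselect (lm_act e (lm_act p.2 xi) = 0).
    by rewrite em lm_act0.
  by case: noe; exists (lm_act p.2 xi).
exists (fun x => lm_act x m); split; first by move=> *; rewrite lm_actDl.
split; first by move=> *; rewrite lm_actZl.
split; first by move=> *; rewrite lm_actA.
apply: (irrM (fun n => exists x, (exists a, x = a ** e) /\ lm_act x m = n)); last first.
  by exists (lm_act e m); split=> //; exists e; split=> //; exists e.
split; last first.
  move=> a _ [_ [[b ->] <-]]; exists (a ** (b ** e)); rewrite lm_actA.
  by split=> //; exists (a ** b); rewrite nua_mulA.
split.
  exists 0; rewrite (klinear0 (lm_act_klinear m)); split=> //.
  by exists 0; rewrite nua_mul0r.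
split=> [_ _ [_ [[a ->] <-]] [_ [[b ->] <-]]|c _ [_ [[a ->] <-]]].
  by exists (a ** e + b ** e); rewrite lm_actDl; split=> //; exists (a + b); rewrite nua_mulDl.
by exists (c *: (a ** e)); rewrite lm_actZl; split=> //; exists (c *: a); rewrite nua_mulZl.
Qed.

Definition left_ideal (N : A -> Prop) : Prop :=
  subspace N /\ forall a x, N x -> N (a ** x).

Section QuotientModule.
Variables (N : A -> Prop) (N_ideal : left_ideal N).
Local Notation AN := (quot N_ideal.1).

Definition quot_act (a : A) (q : AN) : AN := coset _ (a ** val q).

Lemma quot_act_coset a x : quot_act a (coset _ x) = coset _ (a ** x).
Proof.
apply/eq_cosetP; rewrite -(klinearB _ _ (mull_klinear a)).
by apply: N_ideal.2; apply: sub_cosetP'.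
Qed.

Lemma quot_actDl a b q : quot_act (a + b) q = quot_act a q + quot_act b q.
Proof.
by elim/cosetW: q => x; rewrite !quot_act_coset nua_mulDl; case: (coset_klinear N_ideal.1).
Qed.

Lemma quot_actDr a p q : quot_act a (p + q) = quot_act a p + quot_act a q.
Proof.
elim/cosetW: p => x; elim/cosetW: q => y.
by case: (coset_klinear N_ideal.1) => D _; rewrite -D !quot_act_coset nua_mulDr D.
Qed.

Lemma quot_actZl c a q : quot_act (c *: a) q = c *: quot_act a q.
Proof.
by elim/cosetW: q => x; rewrite !quot_act_coset nua_mulZl; case: (coset_klinear N_ideal.1).
Qed.

Lemma quot_actZr c a q : quot_act a (c *: q) = c *: quot_act a q.
Proof.
elim/cosetW: q => x.
by case: (coset_klinear N_ideal.1) => _ Z; rewrite -Z !quot_act_coset nua_mulZr Z.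
Qed.

Lemma quot_actA a b q : quot_act (a ** b) q = quot_act a (quot_act b q).
Proof. by elim/cosetW: q => x; rewrite !quot_act_coset nua_mulA. Qed.

Definition quot_module : lmodule A :=
  LModule quot_actDl quot_actDr quot_actZl quot_actZr quot_actA.

End QuotientModule.

(** Zorn's lemma, for the left ideals that contain [N0] and avoid [x]. Maximality is relative to
    this family: a strictly larger left ideal must contain [x]. *)
Lemma maximal_left_ideal (N0 : A -> Prop) x :
  left_ideal N0 -> ~ N0 x ->
  exists N, [/\ left_ideal N, (forall y, N0 y -> N y), ~ N x &
    forall N', left_ideal N' -> (forall y, N y -> N' y) -> ~ N' x ->
      forall y, N' y -> N y].
Proof.
move=> N0_ideal N0x.
pose good N := [/\ left_ideal N, (forall y, N0 y -> N y) & ~ N x].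
(* the empty set is allowed as the union of the empty chain *)
pose P (N : A -> Prop) := good N \/ forall y, ~ N y.
have [|N [[[N_ideal N0N Nx]|N_empty] N_max]] :=
  @classical_sets.Zorn_bigcup A P.
- move=> F FP F_tot; have [[X FX X_good]|noX] := pselect (exists2 X, F X & good X); last first.
    right=> y [X FX Xy]; case: (FP _ FX) => [X_good|/(_ y)//].
    by apply: noX; exists X.
  left; case: (X_good) => [[[X0 _] _] N0X _].
  have F_good Y y : F Y -> Y y -> good Y by move=> FY Yy; case: (FP _ FY) => // /(_ y).
  split.
  - split; last first.
      by move=> a y [Y FY Yy]; exists Y => //; case: (F_good _ _ FY Yy) => -[_ + _ _]; apply.
    split; first by exists X.
    split=> [y z [Y FY Yy] [Z FZ Zz]|c y [Y FY Yy]].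
      have [YZ|ZY] := F_tot _ _ FY FZ.
        exists Z => //; case: (F_good _ _ FZ Zz) => -[[_ [ZD _]] _] _ _.
        by apply: ZD => //; apply: YZ.
      exists Y => //; case: (F_good _ _ FY Yy) => -[[_ [YD _]] _] _ _.
      by apply: YD => //; apply: ZY.
    by exists Y => //; case: (F_good _ _ FY Yy) => -[[_ [_ YZ]] _] _ _; apply: YZ.
  - by move=> y /N0X; exists X.
  - by move=> [Y FY Yx]; case: (F_good _ _ FY Yx).
- exists N; split=> // N' N'_ideal NN' N'x; apply: contrapT => N'N.
  apply: (N_max N'); last by left; split=> // y /N0N/NN'.
  by split=> // N'N1; apply: N'N => y; apply: N'N1.
(* The maximal element cannot be the empty set, since [N0] is admissible and contains 0. *)
- case: (N_max N0); last by left.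
  split=> [y /N_empty//|N0N]; apply: (N_empty 0); apply: N0N.
  by case: N0_ideal => -[].
Qed.

End Algebra.

(** * Local units of an AUF algebra, and fullness of generating idempotents *)

Section AUFAlgebra.
Variables (K : fieldType) (A : nualg K) (I : eqType) (e : I -> A).
Hypothesis e_idem : forall i, idempotent (e i).
Hypothesis e_orth : forall i j, i <> j -> e i ** e j = 0.
Hypothesis e_span : forall x : A, exists (n : nat) (ij : 'I_n -> I * I) (y : 'I_n -> A),
  x = \sum_(k < n) e (ij k).1 ** y k ** e (ij k).2.

Local Notation u s := (\sum_(i <- s) e i).

Lemma unit_mull (s : seq I) i : uniq s -> u s ** e i = if i \in s then e i else 0.
Proof.
move=> s_uniq; rewrite nua_mul_suml; case: ifPn => is_; last first.
  rewrite big_seq big1 // => j js; apply: e_orth => ji.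
  by rewrite -ji js in is_.
rewrite (bigD1_seq i) //= e_idem big1 ?addr0 // => j ji.
by apply: e_orth; apply/eqP.
Qed.

Lemma unit_mulr (s : seq I) i : uniq s -> e i ** u s = if i \in s then e i else 0.
Proof.
move=> s_uniq; rewrite nua_mul_sumr; case: ifPn => is_; last first.
  rewrite big_seq big1 // => j js; apply: e_orth => ji.
  by rewrite ji js in is_.
rewrite (bigD1_seq i) //= e_idem big1 ?addr0 // => j ji.
by apply: e_orth; apply/nesym/eqP.
Qed.

(** The list [s] collects all left and right indices of one expression of [x], so [u s] fixes every
    term on both sides. Vanishing outside [s] then follows by orthogonality. *)
Lemma local_unit x : exists s, [/\ uniq s, u s ** x = x, x ** u s = x,
  (forall i, i \notin s -> e i ** x = 0) & (forall i, i \notin s -> x ** e i = 0)].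
Proof.
have [n [ij [y xE]]] := e_span x.
pose s := undup ([seq (ij k).1 | k <- enum 'I_n] ++ [seq (ij k).2 | k <- enum 'I_n]).
have s_uniq : uniq s by apply: undup_uniq.
have s1 k : (ij k).1 \in s.
  by rewrite mem_undup mem_cat; apply/orP/or_introl/mapP; exists k; rewrite ?mem_enum.
have s2 k : (ij k).2 \in s.
  by rewrite mem_undup mem_cat; apply/orP/or_intror/mapP; exists k; rewrite ?mem_enum.
have ux : u s ** x = x.
  rewrite [in LHS]xE nua_mul_sumr [RHS]xE; apply: eq_bigr => k _.
  by rewrite !nua_mulA unit_mull // s1.
have xu : x ** u s = x.
  rewrite [in LHS]xE nua_mul_suml [RHS]xE; apply: eq_bigr => k _.
  by rewrite -nua_mulA unit_mulr // s2.
exists s; split=> // i /negPf is_.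
  by rewrite -ux nua_mulA unit_mulr // is_ nua_mul0r.
by rewrite -xu -nua_mulA unit_mull // is_ nua_mulr0.
Qed.

Lemma generating_full (a : A) : generating a -> full a.
Proof.
move=> [aa a_gen] x.
have [s [s_uniq <- _ _ _]] := local_unit x.
apply: two_sided_mulr; apply: two_sided_sum => i; apply: contrapT => eiJ.
(* The starting left ideal $\{y : y e_i \in AaA\}$ contains $AaA$ and also every $y - y e_i$. Thus
   $y$ and $y e_i$ agree in the quotient, which the class of $e_i$ generates. *)
have N0_ideal : left_ideal (fun y => two_sided a (y ** e i)).
  have [J0 [JD JZ]] := two_sided_subspace a.
  split; last by move=> b y Jy; rewrite -nua_mulA; apply: two_sided_mull.
  split; first by rewrite nua_mul0r.
  split=> [y z Jy Jz|c y Jy]; first by rewrite nua_mulDl; apply: JD.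
  by rewrite nua_mulZl; apply: JZ.
have [|N [N_ideal N0N Nei N_max]] := @maximal_left_ideal _ _ _ (e i) N0_ideal.
  by rewrite e_idem.
have [S_sub NM] := N_ideal.
have Nsub y : N (y - y ** e i).
  apply: N0N; rewrite (klinearB _ _ (mulr_klinear (e i))) -nua_mulA e_idem subrr.
  by case: (two_sided_subspace a).
pose S := quot_module N_ideal.
have qc : quasicoherent S.
  elim/cosetW => y; have [t [_ uy _ _ _]] := local_unit y.
  by exists (u t); rewrite /= quot_act_coset uy.
have irr : irreducible S.
  split; first by exists (coset _ (e i)) => /coset_eq0.
  move=> P [P_sub PM] [m [Pm m0]].
  (* The preimage of a nonzero submodule is strictly larger than [N], so by maximality it contains
     $e_i$, hence every $y = (y - y e_i) + y e_i$. *)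
  pose N' y := P (coset _ y).
  have N'_ideal : left_ideal N'.
    have [cD cZ] := coset_klinear N_ideal.1.
    have [P0 [PD PZ]] := P_sub.
    split; last by move=> b y Py; rewrite /N' -quot_act_coset; apply: PM.
    split; first by rewrite /N' (klinear0 (coset_klinear _)).
    by split=> [y z Py Pz|c y Py]; rewrite /N' (cD, cZ); [apply: PD | apply: PZ].
  have NN' y : N y -> N' y.
    by move=> Ny; rewrite /N' (_ : coset _ y = 0); [case: P_sub | apply/coset_eq0].
  have N'ei : N' (e i).
    apply: contrapT => N'ei; apply: m0.
    elim/cosetW: m Pm => y Py; apply/coset_eq0; exact: N_max N'ei _ Py.
  elim/cosetW => y; rewrite -[y](subrK (y ** e i)).
  case: (N'_ideal) => -[_ [N'D _]] N'M.
  by apply: N'D; [apply/NN'/Nsub | apply: N'M].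
have [f [_ [_ [fM f_surj]]]] := a_gen S qc irr.
have a_in : exists b, a = b ** a by exists a; rewrite aa.
(* Here $f(a) = f(aa) = a f(a)$, and [a] kills the quotient because $aA \subseteq AaA$. So [f]
   vanishes on $Aa$, although the class of $e_i$ is nonzero. *)
have fa : f a = 0.
  rewrite -aa fM //; move: (f a); elim/cosetW => y.
  rewrite /= quot_act_coset; apply/coset_eq0/N0N.
  by apply: two_sided_mulr; have := two_sided_mid a a y; rewrite aa.
have [_ [[b ->]]] := f_surj (coset _ (e i)).
by rewrite fM // fa lm_act0 => /esym/coset_eq0.
Qed.
End AUFAlgebra.

(** * The corner algebra $aAa$ and the right module $Aa$ *)

Section CornerBimodule.
Variables (K : fieldType) (A : nualg K) (a : A) (a_idem : idempotent a).

(** For an idempotent [a], the fixed-point equation $xa = x$ cuts out $Aa$; together with $ax = x$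
    it cuts out $aAa$. *)
Lemma right_subspace : subspace (fun x => x ** a = x).
Proof.
split; first exact: nua_mul0r.
by split=> [x y xa ya|c x xa]; rewrite (nua_mulDl, nua_mulZl) xa ?ya.
Qed.

Lemma corner_subspace : subspace (fun x => a ** x = x /\ x ** a = x).
Proof.
split; first by rewrite nua_mul0r nua_mulr0.
split=> [x y [ax xa] [ay ya]|c x [ax xa]].
  by rewrite nua_mulDl nua_mulDr ax xa ay ya.
by rewrite nua_mulZl nua_mulZr ax xa.
Qed.

Local Notation Me := (subsp right_subspace).
Local Notation Be := (subsp corner_subspace).

Lemma to_right_subproof x : x ** a ** a = x ** a.
Proof. by rewrite -nua_mulA a_idem. Qed.

Definition to_right x : Me := to_subsp right_subspace (to_right_subproof x).

Lemma to_corner_subproof x : a ** (a ** x ** a) = a ** x ** a /\ a ** x ** a ** a = a ** x ** a.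
Proof. by split; rewrite ?nua_mulA ?a_idem // -nua_mulA a_idem. Qed.

Definition to_corner x : Be := to_subsp corner_subspace (to_corner_subproof x).

Lemma val_right x : val (to_right x) = x ** a.
Proof. exact: to_subspK. Qed.

Lemma val_corner x : val (to_corner x) = a ** x ** a.
Proof. exact: to_subspK. Qed.

Lemma right_mul (m : Me) : val m ** a = val m.
Proof. exact: (subspP m). Qed.

Lemma corner_mull (b : Be) : a ** val b = val b.
Proof. by case: (subspP b). Qed.

Lemma corner_mulr (b : Be) : val b ** a = val b.
Proof. by case: (subspP b). Qed.

Lemma to_right_klinear : klinear to_right.
Proof.
split=> [x y|c x]; apply: subsp_inj; rewrite (subspD, subspZ) !val_right.
  by rewrite nua_mulDl.
by rewrite nua_mulZl.
Qed.

Lemma right_act_subproof (m : Me) (b : Be) : val m ** val b ** a = val m ** val b.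
Proof. by rewrite -nua_mulA corner_mulr. Qed.

Lemma corner_mul_subproof (b c : Be) :
  a ** (val b ** val c) = val b ** val c /\ val b ** val c ** a = val b ** val c.
Proof. by rewrite nua_mulA corner_mull -nua_mulA corner_mulr. Qed.

Definition right_act (m : Me) (b : Be) : Me := to_subsp right_subspace (right_act_subproof m b).
Definition corner_mul (b c : Be) : Be := to_subsp corner_subspace (corner_mul_subproof b c).

Lemma val_act m b : val (right_act m b) = val m ** val b.
Proof. exact: to_subspK. Qed.

Lemma val_corner_mul b c : val (corner_mul b c) = val b ** val c.
Proof. exact: to_subspK. Qed.

Definition corner_nualg : nualg K.
Proof.
apply: (@NUAlg _ Be corner_mul) => [x y z|x y z|x y z|c x y|c x y]; apply: subsp_inj;
  rewrite !(val_corner_mul, subspD, subspZ).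
- exact: nua_mulA.
- exact: nua_mulDl.
- exact: nua_mulDr.
- exact: nua_mulZl.
- exact: nua_mulZr.
Defined.

Definition corner_ualg : ualg K.
Proof.
apply: (@UAlg _ corner_nualg (to_corner a)) => x; apply: subsp_inj;
  rewrite [LHS]val_corner_mul val_corner !a_idem.
- exact: corner_mull.
- exact: corner_mulr.
Defined.

Definition right_module : rmodule corner_ualg.
Proof.
apply: (@RModule _ corner_ualg Me right_act) => [m n b|m b c|c m b|c m b|m b c|m]; apply: subsp_inj;
  rewrite !(val_act, subspD, subspZ) ?[val (nua_mul _ _)]val_corner_mul.
- exact: nua_mulDl.
- exact: nua_mulDr.
- exact: nua_mulZl.
- exact: nua_mulZr.
- exact: nua_mulA.
- by change (ua_one corner_ualg) with (to_corner a); rewrite val_corner !a_idem right_mul.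
Defined.

(** The homomorphisms are indexed by [N] itself: [n] gives $m \mapsto n \cdot (am)$, which sends $a
    \in Aa$ to $n \cdot 1 = n$. *)
Lemma right_generator : rgenerator right_module.
Proof.
move=> N; exists N, (fun n (m : right_module) => rm_act n (to_corner (val m) : corner_ualg)); split.
  move=> n; split; first split.
  - move=> x y; rewrite -rm_actDr; congr (rm_act n _); apply: subsp_inj.
    by rewrite val_corner !subspD !val_corner nua_mulDr nua_mulDl.
  - move=> c x; rewrite -rm_actZr; congr (rm_act n _); apply: subsp_inj.
    by rewrite val_corner !subspZ !val_corner nua_mulZr nua_mulZl.
  - move=> m b; rewrite -rm_actA; congr (rm_act n _); apply: subsp_inj.
    rewrite [RHS]val_corner_mul !val_corner val_act -!nua_mulA corner_mulr.
    by rewrite [a ** val b]corner_mull.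
move=> n; exists 1%N, (fun=> n), (fun=> to_right a).
rewrite big_ord1 -[LHS]rm_act1; congr (rm_act n _); apply: subsp_inj.
change (ua_one corner_ualg) with (to_corner a).
by rewrite !val_corner val_right !a_idem.
Qed.

End CornerBimodule.

(** * From a full idempotent [a] to the isomorphism of $A$ with $\mathrm{End}^0(Aa)$ *)

Section FullIdempotent.
Variables (K : fieldType) (A : nualg K) (I : eqType) (e : I -> A).
Hypothesis e_idem : forall i, idempotent (e i).
Hypothesis e_orth : forall i j, i <> j -> e i ** e j = 0.
Hypothesis e_findim : forall i j,
  findim (fun x : A => exists y : A, x = e i ** y ** e j).
Hypothesis e_span : forall x : A, exists (n : nat) (ij : 'I_n -> I * I) (y : 'I_n -> A),
  x = \sum_(k < n) e (ij k).1 ** y k ** e (ij k).2.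
Variables (a : A) (a_idem : idempotent a) (a_full : full a).

Local Notation u s := (\sum_(i <- s) e i).
Local Notation B := (corner_ualg a_idem).
Local Notation M := (right_module a_idem).
Local Notation mk := (to_right a_idem : A -> M).
Local Notation crn := (to_corner a_idem : A -> B).

(** A local unit [u s] of [a] places $e_iAa$ in the finite sum of the $e_iAe_j$ for $j$ in [s]. *)
Lemma right_findim i : findim (fun x : A => e i ** x = x /\ x ** a = x).
Proof.
have [s [s_uniq _ au _ _]] := local_unit e_idem e_orth e_span a.
apply: (findim_image (f := id)) (findim_sum s (e_findim i)) => //.
move=> x [ex xa]; exists x => //; exists (fun j => x ** e j).
  by move=> j; exists x; rewrite ex.
by rewrite -nua_mul_sumr -[x in RHS]xa -nua_mulA au xa.
Qed.

Lemma corner_findim : findim (fun _ : B => True).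
Proof.
have [s [s_uniq ua _ _ _]] := local_unit e_idem e_orth e_span a.
apply: (findim_image (f := crn)) (findim_sum s right_findim).
  split=> [x y|c x]; apply: subsp_inj; rewrite (subspD, subspZ) !val_corner.
    by rewrite nua_mulDr nua_mulDl.
  by rewrite nua_mulZr nua_mulZl.
move=> b _; exists (val b); last first.
  by apply: subsp_inj; rewrite val_corner corner_mull corner_mulr.
exists (fun i => e i ** val b); last first.
  by rewrite -nua_mul_suml -[val b in RHS](corner_mull b) nua_mulA ua corner_mull.
by move=> i; rewrite nua_mulA e_idem -nua_mulA corner_mulr.
Qed.

(** The homogeneous part $e_iAa$, again as a set of fixed points. *)
Definition right_grading (i : I) (m : M) : Prop := e i ** val m = val m.

Lemma right_graded : graded right_grading.
Proof.
rewrite /right_grading; split=> [i|].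
  split; first by rewrite (klinear0 (subsp_klinear _)) nua_mulr0.
  by split=> [x y ex ey|c x ex];
    rewrite (subspD, subspZ) (nua_mulDr, nua_mulZr) ex ?ey.
split=> [i|].
  apply: findim_image (to_right_klinear a_idem) _ (right_findim i) => m em.
  exists (val m); first by rewrite right_mul.
  by apply: subsp_inj; rewrite val_right right_mul.
split=> [i m b em|]; first by rewrite val_act nua_mulA em.
split=> [m|n idx x idx_inj ex x0 k].
  have [s [s_uniq um _ _ _]] := local_unit e_idem e_orth e_span (val m).
  exists (size s), (tnth (in_tuple s)), (fun k => mk (e (tnth (in_tuple s) k) ** val m)).
  split=> [k|]; first by rewrite val_right !nua_mulA e_idem.
  rewrite -(big_tnth _ _ s xpredT (fun i => mk (e i ** val m))).
  rewrite -(klinear_sum _ _ (to_right_klinear a_idem)); apply: subsp_inj.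
  by rewrite val_right -nua_mul_suml um right_mul.
apply: subsp_inj; rewrite (klinear0 (subsp_klinear _)).
have : e (idx k) ** val (\sum_(k < n) x k) = 0.
  by rewrite x0 (klinear0 (subsp_klinear _)) nua_mulr0.
rewrite (klinear_sum _ _ (subsp_klinear _)) nua_mul_sumr (bigD1 k) //= big1.
  by rewrite addr0 ex.
move=> j jk; rewrite -(ex j) nua_mulA e_orth ?nua_mul0r //.
by move=> /idx_inj kj; rewrite kj eqxx in jk.
Qed.

Definition factors : {d : I -> seq (A * A) |
  forall i, e i = \sum_(p <- d i) p.1 ** a ** p.2}.
Proof. by have [d dP] := choice (fun i => a_full (e i)); exists d. Qed.
Local Notation d := (sval factors).

(* The maps [m |-> a (p.2 e_i m)], valued in [aAa], and the elements [p.1 a], for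
   [p] in [d i], form a dual basis of [e_i A a]. *)
Lemma dual_basis (N : rmodule B) (f : M -> N) i (m : M) : rhom f ->
  f (mk (e i ** val m)) =
  \sum_(p <- d i) rm_act (f (mk p.1)) (crn (p.2 ** e i ** val m)).
Proof.
move=> [f_lin fB]; under eq_bigr do rewrite -fB.
rewrite -klinear_sum //; congr f; apply: subsp_inj.
rewrite (klinear_sum _ _ (subsp_klinear _)) val_right.
rewrite -{1}[e i](e_idem i) {1}(svalP factors i) !nua_mul_suml.
apply: eq_bigr => p _.
by rewrite val_act val_right val_corner !nua_mulA -[_ ** a ** a]nua_mulA a_idem.
Qed.

Definition support_of : {s : M -> seq I | forall m,
  [/\ uniq (s m), u (s m) ** val m = val m & forall i, i \notin s m -> e i ** val m = 0]}.
Proof.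
have H (m : M) : exists s : seq I,
  [/\ uniq s, u s ** val m = val m & forall i, i \notin s -> e i ** val m = 0].
  by have [s [? ? _ ? _]] := local_unit e_idem e_orth e_span (val m); exists s.
by have [s sP] := choice H; exists s.
Qed.
Local Notation supp := (sval support_of).

(** The condition bears on the images under [f], not on the components of [m]. Thus, for an
    endomorphism in $\mathrm{End}^0$, one list [t] serves every [m]. *)
Lemma rhom_sum (N : rmodule B) (f : M -> N) (m : M) (t : seq I) : rhom f ->
  uniq t -> (forall i, i \notin t -> f (mk (e i ** val m)) = 0) ->
  f m = \sum_(i <- t) f (mk (e i ** val m)).
Proof.
move=> [f_lin fB] t_uniq ft; have [s_uniq um es] := svalP support_of m.
rewrite -(@big_supp _ _ (supp m) t) // => [|i /es->]; last first.
  by rewrite (klinear0 (to_right_klinear _)) klinear0.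
rewrite -klinear_sum // -(klinear_sum _ _ (to_right_klinear a_idem)).
by congr f; apply: subsp_inj; rewrite val_right -nua_mul_suml um right_mul.
Qed.

(** The lift is read off the dual basis: preimages under [g] of the values of [f] at the basis
    elements replace these values in [dual_basis]. The section [sec] is only a function, but [h_ i]
    is linear because its argument enters through the coefficients alone. *)
Lemma right_projective : rprojective M.
Proof.
move=> N P g f g_hom g_surj f_hom; have [[g_lin gB] [f_lin fB]] := (g_hom, f_hom).
have [sec secK] := choice g_surj.
pose h_ i (x : A) : N := \sum_(p <- d i) rm_act (sec (f (mk p.1))) (crn (p.2 ** e i ** x)).
have h_lin i : klinear (h_ i).
  split=> [x y|c x]; rewrite /h_ ?scaler_sumr -?big_split; apply: eq_bigr => p _ /=;
    rewrite -?rm_actDr -?rm_actZr; congr rm_act; apply: subsp_inj;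
    rewrite (subspD, subspZ) !val_corner.
    by rewrite !nua_mulDr nua_mulDl.
  by rewrite !nua_mulZr nua_mulZl.
have h_act i (m : M) b : h_ i (val (rm_act m b)) = rm_act (h_ i (val m)) b.
  rewrite /h_ (@klinear_sum _ _ _ (fun n => rm_act n b)); last first.
    by split=> *; rewrite (rm_actDl, rm_actZl).
  apply: eq_bigr => p _; rewrite -rm_actA; congr rm_act; apply: subsp_inj.
  by rewrite [RHS]val_corner_mul !val_corner val_act -!nua_mulA corner_mulr corner_mull.
have h_supp i (m : M) : e i ** val m = 0 -> h_ i (val m) = 0.
  move=> em; rewrite /h_ big1 // => p _; rewrite -nua_mulA em.
  rewrite (_ : crn _ = 0); last first.
    by apply: subsp_inj; rewrite val_corner !nua_mulr0 nua_mul0r (klinear0 (subsp_klinear _)).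
  by rewrite -[0 : B](scale0r 0) rm_actZr scale0r.
pose h m := \sum_(i <- supp m) h_ i (val m).
(* Any list containing the support of [m] computes [h m], so additivity can be checked on a common
   list. *)
have hE (m : M) (t : seq I) : uniq t -> (forall i, i \notin t -> e i ** val m = 0) ->
    h m = \sum_(i <- t) h_ i (val m).
  move=> t_uniq et; have [s_uniq _ es] := svalP support_of m.
  by apply: big_supp => // i it; apply: h_supp; [apply: es | apply: et].
exists h; split; first split; first split.
- move=> m n.
  have [_ _ em] := svalP support_of m; have [_ _ en] := svalP support_of n.
  pose t := undup (supp m ++ supp n).
  have [tm tn] : (forall i, i \notin t -> i \notin supp m) /\
      (forall i, i \notin t -> i \notin supp n).
    by split=> i; rewrite mem_undup mem_cat negb_or => /andP[].
  have t_uniq : uniq t := undup_uniq _.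
  rewrite (hE m t) ?(hE n t) ?(hE (m + n) t) //.
  + by rewrite -big_split; apply: eq_bigr => i _; rewrite subspD; case: (h_lin i).
  + by move=> i it; rewrite subspD nua_mulDr em ?en ?addr0; auto.
  + by move=> i /tn/en.
  + by move=> i /tm/em.
- move=> c m; have [s_uniq _ em] := svalP support_of m.
  rewrite (hE _ (supp m)) // => [|i it]; last by rewrite subspZ nua_mulZr em ?scaler0.
  by rewrite scaler_sumr; apply: eq_bigr => i _; rewrite subspZ; case: (h_lin i).
- move=> m b; have [s_uniq _ em] := svalP support_of m.
  rewrite (hE _ (supp m)) // => [|i it]; last by rewrite val_act nua_mulA em ?nua_mul0r.
  rewrite /h (@klinear_sum _ _ _ (fun n => rm_act n b)); last first.
    by split=> *; rewrite (rm_actDl, rm_actZl).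
  by apply: eq_bigr => i _; apply: h_act.
move=> m; have [s_uniq _ em] := svalP support_of m.
rewrite (rhom_sum f_hom s_uniq) => [|i /em->]; last first.
  by rewrite (klinear0 (to_right_klinear _)) klinear0.
rewrite klinear_sum //; apply: eq_bigr => i _.
rewrite dual_basis // klinear_sum //; apply: eq_bigr => p _.
by rewrite gB secK.
Qed.

Lemma right_iso : iso_End0 A right_grading.
Proof.
exists (fun x m => mk (x ** val m)).
have valE x (m : M) : val (mk (x ** val m)) = x ** val m.
  by rewrite val_right -nua_mulA right_mul.
split=> [x|].
  split; first split=> [m n|c m].
  - by apply: subsp_inj; rewrite valE !subspD !valE nua_mulDr.
  - by apply: subsp_inj; rewrite valE !subspZ !valE nua_mulZr.
  split=> [m b|]; first by apply: subsp_inj; rewrite !(valE, val_act) nua_mulA.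
  have [s [_ _ _ _ xs]] := local_unit e_idem e_orth e_span x.
  exists (size s), (tnth (in_tuple s)) => i i_out m em.
  apply: subsp_inj; rewrite valE (klinear0 (subsp_klinear _)) -em nua_mulA xs ?nua_mul0r //.
  by apply/negP => /(tnthP (in_tuple s))[k ik]; apply: (i_out k).
split; first by move=> x y m; apply: subsp_inj; rewrite subspD !valE nua_mulDl.
split; first by move=> c x m; apply: subsp_inj; rewrite subspZ !valE nua_mulZl.
split; first by move=> x y m; apply: subsp_inj; rewrite !valE nua_mulA.
split=> [x y xy|T [T_lin [TB [n [s sT]]]]].
  (* The difference $x - y$ kills $Aa$, hence $AaA = A$, and in particular its own right local
     unit. *)
  apply/eqP; rewrite -subr_eq0; apply/eqP.
  have [t [_ _ <- _ _]] := local_unit e_idem e_orth e_span (x - y).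
  have [r ->] := a_full (u t); rewrite nua_mul_sumr big1 // => p _.
  have := congr1 val (xy (mk p.1)); rewrite !valE val_right => xyp.
  by rewrite nua_mulA (klinearB _ _ (mulr_klinear _)) xyp subrr nua_mul0r.
have T_hom : rhom T by [].
pose t := undup (codom s).
(* Outside [t] the map [T] kills the homogeneous parts. Summing the dual basis formula over [t]
   writes $Tm$ as the product of this element with [m]. *)
exists (\sum_(i <- t) \sum_(p <- d i) val (T (mk p.1)) ** (a ** p.2 ** e i)) => m.
rewrite [RHS](@rhom_sum _ _ _ t T_hom); last first.
- move=> i; rewrite mem_undup => /codomP i_out; apply: (sT i) => [k ski|].
    by apply: i_out; exists k.
  by rewrite /right_grading valE nua_mulA e_idem.
- exact: undup_uniq.
apply: subsp_inj; rewrite valE nua_mul_suml (klinear_sum _ _ (subsp_klinear _)).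
apply: eq_bigr => i _; rewrite dual_basis // nua_mul_suml (klinear_sum _ _ (subsp_klinear _)).
apply: eq_bigr => p _.
by rewrite val_act val_corner -!nua_mulA right_mul.
Qed.

End FullIdempotent.

(** * Homogeneous components and projections of a graded module *)

Section GradedModule.
Variables (K : fieldType) (B : ualg K) (M : rmodule B) (I : eqType) (G : I -> M -> Prop).
Hypothesis G_graded : graded G.

Let G_sub i : subspace (G i). Proof. by case: G_graded. Qed.

Lemma rm_actl_klinear b : klinear (fun m : M => rm_act m b).
Proof. by split=> *; rewrite (rm_actDl, rm_actZl). Qed.

Lemma rm_actr_klinear (m : M) : klinear (fun b : B => rm_act m b).
Proof. by split=> *; rewrite (rm_actDr, rm_actZr). Qed.

(** The components form a function on all of [I], with [s] containing its support, so that two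
    decompositions can be compared at each index. *)
Definition decomposes (m : M) (x : I -> M) (s : seq I) : Prop :=
  [/\ uniq s, (forall i, G i (x i)), (forall i, i \notin s -> x i = 0) &
      m = \sum_(i <- s) x i].

Lemma decomposition m : exists x s, decomposes m x s.
Proof.
case: G_graded => _ [_ [_ [/(_ m)[n [idx [x [xG ->]]]] _]]].
(* An index may occur several times in [idx]; summands with equal index are collected. *)
exists (fun i => \sum_(k < n) if idx k == i then x k else 0), (undup (codom idx)).
split; first exact: undup_uniq.
- move=> i; apply: subspace_sum => // k; case: eqP => [<-//|_].
  by case: (G_sub i).
- move=> i; rewrite mem_undup => /codomP i_out; rewrite big1 // => k _.
  by case: eqP => // ki; case: i_out; exists k.
rewrite exchange_big; apply: eq_bigr => k _ /=.
rewrite (bigD1_seq (idx k)) ?undup_uniq ?mem_undup ?codom_f //= eqxx big1 ?addr0 //.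
by move=> i; rewrite eq_sym => /negPf->.
Qed.

Lemma decomposition_uniq m x y s t i :
  decomposes m x s -> decomposes m y t -> x i = y i.
Proof.
move=> [s_uniq xG xs mx] [t_uniq yG yt my].
(* Adjoining [i] lets independence be applied at [i] even if it lies in neither list. *)
pose r := undup (i :: s ++ t).
have r_uniq : uniq r by apply: undup_uniq.
have [rs rt] : (forall j, j \notin r -> j \notin s) /\ (forall j, j \notin r -> j \notin t).
  by split=> j; rewrite mem_undup inE mem_cat !negb_or => /and3P[].
have ir : i \in r by rewrite mem_undup mem_head.
have ilt : (index i r < size r)%N by rewrite index_mem.
case: G_graded => _ [_ [_ [_ indep]]].
have := indep _ (tnth (in_tuple r)) (fun k => x (tnth (in_tuple r) k) - y (tnth (in_tuple r) k)).
have inj_r : injective (tnth (in_tuple r)) by apply/tuple_uniqP.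
move=> /(_ inj_r _ _ (Ordinal ilt)).
rewrite (tnth_nth i) /= nth_index // => xy; apply/eqP; rewrite -subr_eq0; apply/eqP/xy.
  by move=> k; apply: subspaceB.
rewrite -(big_tnth _ _ r xpredT (fun j => x j - y j)) sumrB.
rewrite (@big_supp _ _ r s) // => [|j /rs/xs//].
by rewrite (@big_supp _ _ r t) // => [|j /rt/yt//]; rewrite -mx -my subrr.
Qed.

Lemma decomposesD m n x y s t : decomposes m x s -> decomposes n y t ->
  exists r, decomposes (m + n) (fun i => x i + y i) r.
Proof.
move=> [s_uniq xG xs mx] [t_uniq yG yt my].
pose r := undup (s ++ t); exists r.
have [rs rt] : (forall j, j \notin r -> j \notin s) /\ (forall j, j \notin r -> j \notin t).
  by split=> j; rewrite mem_undup mem_cat !negb_or => /andP[].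
split; first exact: undup_uniq.
- by move=> i; case: (G_sub i) => _ [+ _]; apply.
- by move=> i ir; rewrite xs ?yt ?addr0; auto.
rewrite big_split /= (@big_supp _ _ r s) ?undup_uniq // => [|j /rs/xs//].
by rewrite (@big_supp _ _ r t) ?undup_uniq // => [|j /rt/yt//]; rewrite -mx -my.
Qed.

Lemma decomposes_map m x s (f : M -> M) : klinear f ->
  (forall i n, G i n -> G i (f n)) -> decomposes m x s ->
  decomposes (f m) (f \o x) s.
Proof.
move=> f_lin fG [s_uniq xG xs mx]; split=> // [i|i /xs xi|].
- exact/fG/xG.
- by rewrite /= xi klinear0.
by rewrite mx klinear_sum.
Qed.

Lemma decomposes_homog i m :
  G i m -> decomposes m (fun j => if j == i then m else 0) [:: i].
Proof.
move=> mG; split=> //; last by rewrite big_seq1 eqxx.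
- by move=> j; case: eqP => [->//|_]; case: (G_sub j).
- by move=> j; rewrite inE => /negPf->.
Qed.

(** The projections read the components of a chosen decomposition. By uniqueness, exhibiting some
    decomposition of a vector determines its projections, which yields each property in turn. *)
Lemma grading_projections : exists p : I -> M -> M,
  (forall i, klinear (p i)) /\
  (forall i m b, p i (rm_act m b) = rm_act (p i m) b) /\
  (forall i m, G i (p i m)) /\
  (forall i m, G i m -> p i m = m) /\
  (forall i j m, i <> j -> G j m -> p i m = 0) /\
  (forall m, exists s, [/\ uniq s, (forall i, i \notin s -> p i m = 0) &
     m = \sum_(i <- s) p i m]).
Proof.
have [p pP] := choice decomposition.
have pE m x s i : decomposes m x s -> p m i = x i.
  by have [t pt] := pP m; apply: decomposition_uniq pt.
exists (fun i m => p m i); split.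
  move=> i; split=> [m n|c m]; have [s ms] := pP m.
    by have [t nt] := pP n; have [r /pE->] := decomposesD ms nt.
  rewrite (pE _ _ _ i (decomposes_map (f := fun n => c *: n) _ _ ms)) //.
    split=> [x y|c' x]; first by rewrite scalerDr.
    by rewrite !scalerA mulrC.
  by move=> j n nG; case: (G_sub j) => _ [_]; apply.
split=> [i m b|].
  have [s ms] := pP m.
  rewrite (pE _ _ _ i (decomposes_map (rm_actl_klinear b) _ ms)) // => j n.
  by case: G_graded => _ [_ [GB _]]; apply: GB.
split=> [i m|]; first by have [s []] := pP m.
split=> [i m /decomposes_homog/pE->|]; first by rewrite eqxx.
split=> [i j m ij /decomposes_homog/pE->|m]; first by case: eqP.
by have [s []] := pP m; exists s.
Qed.

End GradedModule.

(** * The regular module and finite powers of a module *)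

Definition regular_rmodule (K : fieldType) (B : ualg K) : rmodule B.
Proof.
apply: (@RModule _ B B (fun x b => x ** b)) => [x y b|x b c|c x b|c x b|x b c|x].
- exact: nua_mulDl.
- exact: nua_mulDr.
- exact: nua_mulZl.
- exact: nua_mulZr.
- exact: nua_mulA.
- exact: ua_mul1r.
Defined.

Definition power_rmodule (K : fieldType) (B : ualg K) (M : rmodule B) (J : finType) : rmodule B.
Proof.
apply: (@RModule _ B {ffun J -> M} (fun f b => [ffun j => rm_act (f j) b]))
  => [f g b|f b c|c f b|c f b|f b c|f]; apply/ffunP => j.
- by rewrite !ffunE rm_actDl.
- by rewrite !ffunE rm_actDr.
- by rewrite !ffunE rm_actZl.
- by rewrite !ffunE rm_actZr.
- by rewrite !ffunE rm_actA.
- by rewrite ffunE rm_act1.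
Defined.

(** * The algebra $\mathrm{End}^0$ of a graded module: AUF structure and a full idempotent *)

Section EndomorphismAlgebra.
Variables (K : fieldType) (A : nualg K) (B : ualg K) (M : rmodule B).
Variables (I : eqType) (G : I -> M -> Prop) (Phi : A -> M -> M) (p : I -> M -> M).
Hypothesis G_findim : forall i, findim (G i).
Hypothesis Phi_End0 : forall a, End0 G (Phi a).
Hypothesis PhiD : forall a b m, Phi (a + b) m = Phi a m + Phi b m.
Hypothesis PhiZ : forall (c : K) a m, Phi (c *: a) m = c *: Phi a m.
Hypothesis PhiM : forall a b m, Phi (a ** b) m = Phi a (Phi b m).
Hypothesis Phi_inj : forall a b, (forall m, Phi a m = Phi b m) -> a = b.
Hypothesis Phi_surj : forall T, End0 G T -> exists a, forall m, Phi a m = T m.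
Hypothesis p_lin : forall i, klinear (p i).
Hypothesis p_act : forall i m b, p i (rm_act m b) = rm_act (p i m) b.
Hypothesis pG : forall i m, G i (p i m).
Hypothesis p_id : forall i m, G i m -> p i m = m.
Hypothesis p_out : forall i j m, i <> j -> G j m -> p i m = 0.
Hypothesis p_sum : forall m, exists s,
  [/\ uniq s, (forall i, i \notin s -> p i m = 0) & m = \sum_(i <- s) p i m].

Lemma p_End0 i : End0 G (p i).
Proof.
split=> //; split=> //; exists 1%N, (fun=> i) => j /(_ ord0) ij m.
exact: p_out.
Qed.

Definition proj_elements : {e : I -> A | forall i m, Phi (e i) m = p i m}.
Proof. by have [e eP] := choice (fun i => Phi_surj (p_End0 i)); exists e. Qed.
Local Notation e := (sval proj_elements).
Let PhiE i m : Phi (e i) m = p i m. Proof. exact: (svalP proj_elements). Qed.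

Lemma Phi_klinear a : klinear (Phi a).
Proof. by case: (Phi_End0 a). Qed.

Lemma Phi_eval_klinear m : klinear (Phi^~ m).
Proof. by split=> *; rewrite (PhiD, PhiZ). Qed.

Lemma Phi_sum (J : Type) (s : seq J) (F : J -> A) m :
  Phi (\sum_(j <- s) F j) m = \sum_(j <- s) Phi (F j) m.
Proof. exact: klinear_sum (Phi_eval_klinear m). Qed.

Lemma proj_idem i : idempotent (e i).
Proof. by apply: Phi_inj => m; rewrite PhiM !PhiE p_id. Qed.

Lemma proj_orth i j : i <> j -> e i ** e j = 0.
Proof.
move=> ij; apply: Phi_inj => m.
by rewrite PhiM !PhiE (p_out ij) // (klinear0 (Phi_eval_klinear m)).
Qed.

Lemma proj_sum m (t : seq I) : uniq t -> (forall i, i \notin t -> p i m = 0) ->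
  m = \sum_(i <- t) p i m.
Proof.
move=> t_uniq mt; have [s [s_uniq ms {1}->]] := p_sum m.
exact: big_supp.
Qed.

(** The vectors provided by [findim] may lie outside $M(i)$; their projections lie inside and still
    span it. *)
Lemma grade_span i : exists s : seq M, forall m, G i m ->
  exists c : 'I_(size s) -> K, m = \sum_(k < size s) c k *: p i s`_k.
Proof.
have [s span] := G_findim i; exists s => m mG; have [c mc] := span m mG; exists c.
rewrite -{1}(p_id mG) {1}mc klinear_sum //.
by apply: eq_bigr => k _; case: (p_lin i).
Qed.

(** An element of $e_iAe_j$ is determined by its values on a finite spanning family of $M(j)$, and
    these values lie in $M(i)$. *)
Lemma proj_findim i j : findim (fun x : A => exists y, x = e i ** y ** e j).
Proof.
have [s span] := grade_span j.
apply: (@findim_inj _ _ {ffun 'I_(size s) -> M} _ (fun f => forall k, G i (f k))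
  (fun x => [ffun k : 'I_(size s) => Phi x (p j s`_k)])).
- split=> [x y|c x]; apply/ffunP => k; rewrite ?scale_ffunE !ffunE.
    exact: PhiD.
  exact: PhiZ.
- split; first by exists 0; rewrite nua_mulr0 nua_mul0r.
  split=> [_ _ [x ->] [y ->]|c _ [x ->]].
    by exists (x + y); rewrite nua_mulDr nua_mulDl.
  by exists (c *: x); rewrite nua_mulZr nua_mulZl.
- move=> _ [x ->] /ffunP x0; apply: Phi_inj => m.
  rewrite (klinear0 (Phi_eval_klinear m)).
  have -> : Phi (e i ** x ** e j) m = Phi (e i ** x ** e j) (p j m).
    by rewrite !PhiM !PhiE (p_id (pG j m)).
  have [c ->] := span _ (pG j m).
  rewrite (klinear_sum _ _ (Phi_klinear _)) big1 // => k _.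
  case: (Phi_klinear (e i ** x ** e j)) => _ ->.
  by have := x0 k; rewrite !ffunE => ->; rewrite scaler0.
- by move=> _ [x ->] k; rewrite ffunE !PhiM PhiE.
- exact: findim_ffun.
Qed.

(** Since $M(i)$ is finite-dimensional, [x] maps it into finitely many homogeneous parts: those met
    by the images of a spanning family. *)
Lemma proj_mulr_span x i : exists t : seq I, x ** e i = \sum_(j <- t) e j ** x ** e i.
Proof.
have [s span] := grade_span i.
have [supp suppP] := choice p_sum.
pose t := undup (flatten [seq supp (Phi x (p i m)) | m <- s]); exists t.
apply: Phi_inj => m; rewrite Phi_sum PhiM PhiE.
under eq_bigr do rewrite !PhiM !PhiE.
have [c ->] := span _ (pG i m).
apply: proj_sum => [|j jt]; first exact: undup_uniq.
rewrite (klinear_sum _ _ (Phi_klinear _)) klinear_sum // big1 // => k _.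
case: (Phi_klinear x) => _ ->; case: (p_lin j) => _ ->.
have [_ supp_out _] := suppP (Phi x (p i s`_k)); rewrite supp_out ?scaler0 //.
apply: contra jt => jk; rewrite mem_undup; apply/flattenP.
by exists (supp (Phi x (p i s`_k))); rewrite ?map_f ?mem_nth.
Qed.

(** This is the finiteness clause of [End0]: [x] vanishes on all but finitely many homogeneous
    parts. *)
Lemma proj_right_unit x : exists t : seq I, x = \sum_(i <- t) x ** e i.
Proof.
have [_ [_ [n [s xs]]]] := Phi_End0 x.
exists (undup (codom s)); apply: Phi_inj => m; rewrite Phi_sum.
have [t [t_uniq mt mE]] := p_sum m.
rewrite {1}mE (klinear_sum _ _ (Phi_klinear x)).
under [RHS]eq_bigr do rewrite PhiM PhiE.
apply: big_supp => // [|i /mt->|i]; first exact: undup_uniq.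
  exact: klinear0 (Phi_klinear x).
rewrite mem_undup => /codomP i_out; apply: (xs i) => [k ki|//].
by apply: i_out; exists k.
Qed.

Lemma proj_span x : exists (n : nat) (ij : 'I_n -> I * I) (y : 'I_n -> A),
  x = \sum_(k < n) e (ij k).1 ** y k ** e (ij k).2.
Proof.
have [t xt] := proj_right_unit x; have [r rP] := choice (proj_mulr_span x).
pose L := [seq (j, i) | i <- t, j <- r i].
exists (size L), (tnth (in_tuple L)), (fun=> x).
rewrite -(big_tnth _ _ L xpredT (fun ji => e ji.1 ** x ** e ji.2)).
rewrite big_allpairs_dep {1}xt; apply: eq_bigr => i _.
by rewrite {1}rP.
Qed.

Hypothesis M_proj : rprojective M.
Hypothesis M_gen : rgenerator M.

(** The generator property is applied to [B] as a right module over itself, at the element 1. *)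
Lemma generates_unit : exists (n : nat) (f : 'I_n -> M -> B) (m : 'I_n -> M),
  (forall t, @rhom K B M (regular_rmodule B) (f t)) /\
  ua_one B = \sum_(t < n) f t (m t).
Proof.
have [J [f [f_hom f_onto]]] := M_gen (regular_rmodule B).
have [n [j [m one]]] := f_onto (ua_one B).
by exists n, (fun t => f (j t)), m.
Qed.

(* [F] supports the [m t] with [1 = sum_t f t (m t)], so [u = sum_(i in F) e i] is full. *)
Lemma full_idempotent : exists u : A, idempotent u /\ full u.
Proof.
have [n [f [m [f_hom one]]]] := generates_unit.
have [supp suppP] := choice p_sum.
pose F := undup (flatten [seq supp (m t) | t : 'I_n]).
have F_uniq : uniq F by apply: undup_uniq.
pose u := \sum_(i <- F) e i; exists u.
have PhiU x : Phi u x = \sum_(i <- F) p i x.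
  by rewrite Phi_sum; apply: eq_bigr => i _; apply: PhiE.
have u_fix t : Phi u (m t) = m t.
  rewrite PhiU -proj_sum // => i iF; have [_ supp_out _] := suppP (m t).
  apply: supp_out; apply: contra iF => it; rewrite mem_undup; apply/flattenP.
  by exists (supp (m t)); rewrite ?map_f ?mem_enum.
have u_idem : idempotent u.
  rewrite /idempotent {2}/u nua_mul_sumr; apply: eq_big_seq => i iF.
  by rewrite (unit_mull proj_idem proj_orth _ F_uniq) iF.
split=> // x.
(* Since [x] is a sum of elements of the $e_iAe_j$, it suffices to put each $e_i$ in $AuA$. *)
have [l [ij [y ->]]] := proj_span x; apply: two_sided_sum => k; apply: two_sided_mulr.
apply: two_sided_mulr; move: {k} (ij k).1 => i.
have [s span] := grade_span i.
(* The target of the surjection has to be [M]: the coordinates [Some (k, t)] cover $M(i)$, and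
   [None] supplies the complement $(1 - p_i)M$. *)
pose J : finType := option ('I_(size s) * 'I_n).
(* Each [alpha] has values in $M(i)$ and factors through [u]. As $u m_t = m_t$ and $\sum_t f_t(m_t)
   = 1$, the sum over [t] of [alpha (k, t) (m t)] is the [k]-th spanning vector of $M(i)$. *)
pose alpha (kt : 'I_(size s) * 'I_n) x := rm_act (p i s`_kt.1) (f kt.2 (Phi u x)).
have u_act z b : Phi u (rm_act z b) = rm_act (Phi u z) b.
  by have [_ [-> _]] := Phi_End0 u.
have alpha_lin kt : klinear (alpha kt).
  have [[fD fZ] _] := f_hom kt.2; have [uD uZ] := Phi_klinear u.
  by split=> *; rewrite /alpha (uD, uZ) (fD, fZ) (rm_actDr, rm_actZr).
have alpha_act kt z b : alpha kt (rm_act z b) = rm_act (alpha kt z) b.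
  by rewrite /alpha u_act; have [_ ->] := f_hom kt.2; rewrite -rm_actA.
have alpha_End0 kt : End0 G (alpha kt).
  split=> //; split=> //; exists (size F), (tnth (in_tuple F)) => j j_out z zG.
  rewrite /alpha PhiU big_seq big1 => [|q qF]; last first.
    apply: p_out zG => qj; rewrite qj in qF.
    by have /(tnthP (in_tuple F))[w wj] := qF; apply: (j_out w).
  by rewrite (@klinear0 _ _ _ (f kt.2)) ?(klinear0 (rm_actr_klinear _)) //; case: (f_hom kt.2).
pose g (phi : power_rmodule M J) : M :=
  \sum_kt alpha kt (phi (Some kt)) + (phi None - p i (phi None)).
have g_lin : klinear g.
  split=> [phi psi|c phi]; rewrite /g.
    under eq_bigr do rewrite ffunE (alpha_lin _).1.
    by rewrite big_split /= ffunE (p_lin i).1 opprD (addrACA (phi None)) [LHS]addrACA.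
  under eq_bigr do rewrite scale_ffunE (alpha_lin _).2.
  by rewrite scale_ffunE (p_lin i).2 -scalerBr -scaler_sumr -scalerDr.
have g_act phi b : g (rm_act phi b) = rm_act (g phi) b.
  rewrite /g /= ffunE p_act rm_actDl (klinear_sum _ _ (rm_actl_klinear _ b)).
  rewrite (klinearB _ _ (rm_actl_klinear _ b)); congr (_ + _).
  by apply: eq_bigr => kt _; rewrite ffunE alpha_act.
have g_surj z : exists phi, g phi = z.
  have [c zc] := span _ (pG i z).
  (* With these coordinates the sum over [kt] gives $p_i z$, and the coordinate [None] gives $z -
     p_i z$. *)
  exists [ffun o : J => if o is Some kt then c kt.1 *: m kt.2 else z].
  rewrite /g !ffunE; under eq_bigr do rewrite ffunE (alpha_lin _).2.
  rewrite -(pair_bigA _ (fun k t => c k *: alpha (k, t) (m t))) /=.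
  rewrite [X in X + _](_ : _ = p i z); first by rewrite addrC subrK.
  rewrite [RHS]zc; apply: eq_bigr => k _; rewrite -scaler_sumr; congr (_ *: _).
  rewrite -[RHS]rm_act1 one (klinear_sum _ _ (rm_actr_klinear _)).
  by apply: eq_bigr => t _; rewrite /alpha u_fix.
(* Projectivity lifts the identity of [M] along [g]. The coordinates of this section, preceded by
   $p_i$, are the maps [beta], which lie in $\mathrm{End}^0$. *)
have [//|h [[h_lin h_act] gh]] := M_proj (f := id) (conj g_lin g_act) g_surj.
pose beta kt z : M := (h (p i z) : power_rmodule M J) (Some kt).
have beta_End0 kt : End0 G (beta kt).
  split; first split=> [z w|c z]; rewrite /beta.
  - by rewrite (p_lin i).1 h_lin.1 ffunE.
  - by rewrite (p_lin i).2 h_lin.2 scale_ffunE.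
  split; first by move=> *; rewrite /beta p_act h_act ffunE.
  exists 1%N, (fun=> i) => j /(_ ord0) ij' z zG.
  by rewrite /beta (p_out ij' zG) (klinear0 h_lin) ffunE.
have [al alE] := choice (fun kt => Phi_surj (alpha_End0 kt)).
have [be beE] := choice (fun kt => Phi_surj (beta_End0 kt)).
(* Apply $p_i$ to $p_i z = g(h(p_i z))$: the [None] term disappears, and each [alpha] absorbs a
   factor [u] because [u] is idempotent. *)
suff -> : e i = \sum_kt e i ** al kt ** u ** be kt.
  by apply: two_sided_sum => kt; apply: two_sided_mid.
apply: Phi_inj => z; rewrite Phi_sum PhiE -{1}(p_id (pG i z)) -{1}[p i z]gh.
rewrite /g (p_lin i).1 klinearB // (p_id (pG i _)) subrr addr0 klinear_sum //.
apply: eq_bigr => kt _; rewrite !PhiM PhiE alE beE /alpha.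
by rewrite -(PhiM u u) u_idem.
Qed.

End EndomorphismAlgebra.

(** * The equivalence, for algebras over the complex numbers *)

Theorem theorem11p9 (A : nualg CC) :
  strongly_AUF A <->
  exists (B : ualg CC) (M : rmodule B) (I : Type) (G : I -> M -> Prop),
    findim (fun _ : B => True) /\
    projective_generator M /\
    graded G /\
    iso_End0 A G.
Proof.
split=> [[[I [e [e_idem [e_orth [e_findim e_span]]]]] [a a_gen]]|].
  have a_idem := a_gen.1.
  (* The index type is arbitrary; [{classic I}] gives it the decidable equality that lists of
     indices require. *)
  have a_full := generating_full (I := {classic I}) e_idem e_orth e_span a_gen.
  exists (corner_ualg a_idem), (right_module a_idem), {classic I},
    (@right_grading _ _ {classic I} e a a_idem).
  split; first exact: (corner_findim (I := {classic I})).
  split; last first.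
    by split; [exact: (right_graded (I := {classic I})) | exact: (right_iso (I := {classic I}))].
  by split; [exact: (right_projective (I := {classic I})) | exact: right_generator].
move=> [B [M [I [G [_ [[M_proj M_gen] [G_graded]]]]]]].
move=> [Phi [PhiE [PhiD [PhiZ [PhiM [Phi_inj Phi_surj]]]]]].
have [p [p_lin [p_act [pG [p_id [p_out p_sum]]]]]] :=
  grading_projections (I := {classic I}) G_graded.
have G_findim : forall i, findim (G i) by case: G_graded => _ [].
split; last first.
  have [u [u_idem u_full]] := full_idempotent (I := {classic I})
    G_findim PhiE PhiD PhiZ PhiM Phi_inj Phi_surj p_lin p_act pG p_id p_out p_sum M_proj M_gen.
  by exists u; apply: full_generating.
pose e := sval (proj_elements (I := {classic I}) Phi_surj p_lin p_act p_out).
exists {classic I}, e; split=> [i|].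
  exact: proj_idem.
split; first by move=> i j ij; apply: proj_orth.
split; first by move=> i j; apply: proj_findim.
by move=> x; apply: proj_span.
Qed.
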